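(* For $\vec r\in\mathbb{R}^3$ with $|\vec r|\le1$ let $\rho(\vec r)=\tfrac12(I+\vec r\cdot\vec\sigma)$. Let $\vec r_1,\vec r_2$ be in the closed unit ball and linearly dependent (so $\rho(\vec r_1),\rho(\vec r_2)$ commute), and set $m=\max\{|\vec r_1|,|\vec r_2|\}$. Then for every $p\ge1$ $$D^p_{\mathrm{symm},p}(\rho(\vec r_1),\rho(\vec r_2))=2^p\Big(1+\tfrac12|\vec r_1-\vec r_2|-\sqrt{\big(1+\tfrac{\vec r_1\cdot\vec r_2}{m}\big)(1-m)}\Big),$$ with the convention that $\tfrac{\vec r_1\cdot\vec r_2}{m}=0$ when $m=0$.
   Context: Qubit setting: $\mathcal{H}=\mathbb{C}^2$, $\mathcal{H}^*$ is identified with $\mathbb{C}^2$ via the dual basis, and $A^T$ is the usual matrix transpose; operators on $\mathcal{H}\otimes\mathcal{H}^*$ are $4\times4$ matrices in the basis $e_1\otimes e_1^*,e_1\otimes e_2^*,e_2\otimes e_1^*,e_2\otimes e_2^*$. Pauli matrices: $\sigma_1=\sigma_x=\begin{pmatrix}0&1\\1&0\end{pmatrix}$, $\sigma_2=\sigma_y=\begin{pmatrix}0&-i\\i&0\end{pmatrix}$, $\sigma_3=\sigma_z=\begin{pmatrix}1&0\\0&-1\end{pmatrix}$, and $\vec\sigma=(\sigma_1,\sigma_2,\sigma_3)$. The set of couplings of states $\rho,\omega$ is $\mathcal{C}(\rho,\omega)=\{\Pi\in\mathcal{S}(\mathcal{H}\otimes\mathcal{H}^* ):\mathrm{tr}_{\mathcal{H}^*}[\Pi]=\omega,\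 \mathrm{tr}_{\mathcal{H}}[\Pi]=\rho^T\}$. For $p\ge1$, $C_{\mathrm{symm},p}=\sum_{k=1}^3|\sigma_k\otimes I^T-I\otimes\sigma_k^T|^p$, which equals the matrix $\begin{pmatrix}2^p&0&0&-2^p\\0&2^{p+1}&0&0\\0&0&2^{p+1}&0\\-2^p&0&0&2^p\end{pmatrix}$, and $D_{\mathrm{symm},p}(\rho,\omega)=\big(\min_{\Pi\in\mathcal{C}(\rho,\omega)}\mathrm{tr}[\Pi C_{\mathrm{symm},p}]\big)^{1/p}$. *)

(* Defs.v *)
(* R : realType, complex numbers R[i] from mathcomp-real-closed,
   real powers powR from mathcomp-analysis. *)
From mathcomp Require Import all_boot all_order all_algebra.
From mathcomp Require Import complex.
From mathcomp Require Import reals exp.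
From mathcomp Require Import sesquilinear spectral.
Import GRing.Theory Num.Theory.

Set Implicit Arguments.
Unset Strict Implicit.
Unset Printing Implicit Defensive.

Local Open Scope ring_scope.
Local Open Scope complex_scope.
Local Open Scope sesquilinear_scope.

Section QubitDefs.
Variable R : realType.
Local Notation C := R[i].

(* Pauli matrices in the basis e_1, e_2 (indices 0, 1). *)
Definition sigma1 : 'M[C]_2 :=
  \matrix_(a < 2, b < 2) (if (a : nat) == b then 0 else 1).
Definition sigma2 : 'M[C]_2 :=
  \matrix_(a < 2, b < 2)
    (if (a : nat) == b then 0 else if (a : nat) == 0%N then - 'i else 'i).
Definition sigma3 : 'M[C]_2 :=
  \matrix_(a < 2, b < 2)
    (if (a : nat) == b then (if (a : nat) == 0%N then 1 else -1) else 0).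

Definition pauli (k : 'I_3) : 'M[C]_2 :=
  match val k with 0%N => sigma1 | 1%N => sigma2 | _ => sigma3 end.

(* Euclidean dot product and norm on R^3 (row vectors). *)
Definition dot3 (r s : 'rV[R]_3) : R := \sum_(k < 3) r 0 k * s 0 k.
Definition norm3 (r : 'rV[R]_3) : R := Num.sqrt (dot3 r r).

(* Bloch-sphere state rho(r) = 1/2 (I + r . sigma). *)
Definition bloch (r : 'rV[R]_3) : 'M[C]_2 :=
  (2%:R)^-1 *: (1%:M + \sum_(k < 3) (r 0 k)%:C *: pauli k).

(* Positive semidefinite and density matrices (states). *)
Definition psd n (A : 'M[C]_n) : Prop :=
  A ^t* = A /\ forall v : 'rV[C]_n, 0 <= (v *m A *m v ^t*) 0 0.
Definition is_state n (A : 'M[C]_n) : Prop := psd A /\ \tr A = 1.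

(* Index of e_i (x) e_j^* in the ordered basis
   e1(x)e1*, e1(x)e2*, e2(x)e1*, e2(x)e2*  (i.e. 2 i + j). *)
Definition tidx (i j : 'I_2) : 'I_4 := inord (2 * i + j).

(* Partial traces on H (x) H^*. *)
Definition ptr_dual (Pi : 'M[C]_4) : 'M[C]_2 :=   (* tr_{H^*} *)
  \matrix_(a < 2, b < 2) \sum_(j < 2) Pi (tidx a j) (tidx b j).
Definition ptr_H (Pi : 'M[C]_4) : 'M[C]_2 :=      (* tr_H *)
  \matrix_(c < 2, d < 2) \sum_(i < 2) Pi (tidx i c) (tidx i d).

(* Couplings C(rho, omega). *)
Definition coupling (rho omega : 'M[C]_2) (Pi : 'M[C]_4) : Prop :=
  is_state Pi /\ ptr_dual Pi = omega /\ ptr_H Pi = rho ^T.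

(* The cost matrix C_{symm,p}, in its explicit form (as given in the paper):
   [[2^p,0,0,-2^p],[0,2^{p+1},0,0],[0,0,2^{p+1},0],[-2^p,0,0,2^p]]. *)
Definition Csymm (p : R) : 'M[C]_4 :=
  \matrix_(a < 4, b < 4)
    (if (a : nat) == b then
       (if ((a : nat) == 0%N) || ((a : nat) == 3%N) then (2 `^ p)%:C
        else (2 `^ (p + 1))%:C)
     else if ((a : nat) + b == 3%N) && (((a : nat) == 0%N) || ((a : nat) == 3%N))
     then - (2 `^ p)%:C else 0).

(* "v = min_{Pi in C(rho,omega)} tr[Pi C_{symm,p}]", i.e. v = D_{symm,p}(rho,omega)^p:
   the minimum is attained with value v and v is a lower bound. *)
Definition min_cost (p : R) (rho omega : 'M[C]_2) (v : R) : Prop :=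
  (exists Pi, coupling rho omega Pi /\ \tr (Pi *m Csymm p) = v%:C) /\
  (forall Pi, coupling rho omega Pi -> v%:C <= \tr (Pi *m Csymm p)).
End QubitDefs.

(* Main.v *)
(** The cost matrix is 2^p (2 I - |W><W|) with W = e_1 (x) e_1^* + e_2 (x) e_2^*,
    so the cost of a coupling Pi is 2^p (2 - <W|Pi|W>).  Collinear Bloch vectors
    s1 n, s2 n give states diagonal in one orthonormal basis x, y of C^2, with
    first eigenvalues b = (1 + s1) / 2 and a = (1 + s2) / 2, and W is also
    x (x) conj x + y (x) conj y.  The marginals bound the diagonal entries of Pi
    at the two summands by min(a, b) and 1 - max(a, b), and Cauchy-Schwarz for the
    positive form Pi gives <W|Pi|W> <= (sqrt(min(a, b)) + sqrt(1 - max(a, b)))^2.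
    Equality holds for the pure state on the span of the two summands having these
    weights, completed by the missing mass on the off-diagonal basis vectors. *)
Require Import Defs.
From mathcomp Require Import all_boot all_order all_algebra.
From mathcomp Require Import complex.
From mathcomp Require Import reals exp.
From mathcomp Require Import sesquilinear spectral ring lra.
Set Implicit Arguments.
Unset Strict Implicit.
Unset Printing Implicit Defensive.

Import Order.TTheory GRing.Theory Num.Theory.
Local Open Scope ring_scope.

Section Couplings.
Local Open Scope complex_scope.
Local Open Scope sesquilinear_scope.
Variable R : realType.
Local Notation C := R[i].
Implicit Types (x y u v : 'rV[C]_2) (Pi : 'M[C]_4).

(** * Indices and product vectors in the tensor square of C^2 *)

Lemma val_tidx (i j : 'I_2) : tidx i j = (2 * i + j)%N :> nat.
Proof. by rewrite inordK //; case: i => [[|[|//]] ?]; case: j => [[|[|//]] ?]. Qed.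

Lemma ord2P (k : 'I_2) : k = 0 \/ k = 1.
Proof. by case: k => [[|[|//]] ?]; [left|right]; apply/val_inj. Qed.

Lemma sum_ord2 (V : nmodType) (F : 'I_2 -> V) : \sum_i F i = F 0 + F 1.
Proof. by rewrite !big_ord_recl big_ord0 addr0; congr (_ + F _); apply: val_inj. Qed.

Lemma sum_tidx (V : nmodType) (F : 'I_4 -> V) :
  \sum_k F k = \sum_i \sum_j F (tidx i j).
Proof.
rewrite 3!sum_ord2 !big_ord_recl big_ord0 addr0 -!addrA.
by congr (F _ + (F _ + (F _ + F _))); apply: val_inj; rewrite /= val_tidx.
Qed.

Definition tens x y : 'rV[C]_4 :=
  \row_k (x 0 (inord (k %/ 2)) * y 0 (inord (k %% 2))).

Lemma tensE x y i j : tens x y 0 (tidx i j) = x 0 i * y 0 j.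
Proof.
rewrite mxE val_tidx mulnC divnMDl // modnMDl modn_small //.
by rewrite divn_small // addn0 !inord_val.
Qed.

Definition conjv x : 'rV[C]_2 := map_mx Num.conj x.

(* With [x] a unit vector, [x] and [perp x] form an orthonormal basis of C^2. *)
Definition perp x : 'rV[C]_2 :=
  \row_j (if j == 0 then - (x 0 1)^* else (x 0 0)^*)%R.

Definition unitv x := (x 0 0 * (x 0 0)^* + x 0 1 * (x 0 1)^* = 1)%R.

(** Oriented so that [ring: h] can eliminate the monomial on the left. *)
Lemma unitvP x : unitv x -> (x 0 0 * (x 0 0)^* = 1 - x 0 1 * (x 0 1)^*)%R.
Proof. by move=> <-; rewrite addrK. Qed.

(** * Sesquilinear forms: marginals and cost of a coupling *)

Definition qform n (A : 'M[C]_n) (v w : 'rV[C]_n) : C := (v *m A *m w ^t*) 0 0.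

Lemma qformE n (A : 'M[C]_n) (v w : 'rV[C]_n) :
  qform A v w = (\sum_i \sum_j v 0 i * A i j * (w 0 j)^*)%R.
Proof.
rewrite /qform mxE exchange_big; apply: eq_bigr => j _ /=.
by rewrite !mxE mulr_suml.
Qed.

Lemma perp0 x : (perp x 0 0 = - (x 0 1)^*)%R. Proof. by rewrite mxE. Qed.
Lemma perp1 x : (perp x 0 1 = (x 0 0)^*)%R. Proof. by rewrite mxE. Qed.
Lemma conjvE x j : (conjv x 0 j = (x 0 j)^*)%R. Proof. by rewrite mxE. Qed.

(** A partial trace may be taken in any orthonormal basis, here [conjv x], [conjv (perp x)]. When
    [Pi] is positive, each term on the left is thus bounded by a marginal. *)
Lemma qform_ptr_dual Pi u x : unitv x ->
  qform Pi (tens u (conjv x)) (tens u (conjv x)) +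
  qform Pi (tens u (conjv (perp x))) (tens u (conjv (perp x))) =
  qform (ptr_dual Pi) u u.
Proof.
move=> /unitvP h.
rewrite !qformE !sum_tidx !sum_ord2 !sum_tidx !sum_ord2 !tensE !conjvE.
rewrite !perp0 !perp1 !mxE !sum_ord2 !(rmorphM, rmorphN) /= !conjCK.
ring: h.
Qed.

Lemma qform_ptr_H Pi v x : unitv x ->
  qform Pi (tens x v) (tens x v) + qform Pi (tens (perp x) v) (tens (perp x) v) =
  qform (ptr_H Pi) v v.
Proof.
move=> /unitvP h.
rewrite !qformE !sum_tidx !sum_ord2 !sum_tidx !sum_ord2 !tensE.
rewrite !perp0 !perp1 !mxE !sum_ord2 !(rmorphM, rmorphN) /= !conjCK.
ring: h.
Qed.

(** This is why second factors carry conjugated vectors: conjugation undoes the transpose in the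
    marginal [rho^T]. *)
Lemma qform_tr_conjv (A : 'M[C]_2) u : qform A^T (conjv u) (conjv u) = qform A u u.
Proof. rewrite !qformE !sum_ord2 !conjvE !mxE !conjCK; ring. Qed.

(* The matrix with eigenvalues [a], [b] on the orthonormal basis [x], [perp x]. *)
Definition spin_mx x (a b : R) : 'M[C]_2 :=
  a%:C *: (x ^t* *m x) + b%:C *: ((perp x) ^t* *m perp x).

Lemma qform_spin_mx x a b : unitv x ->
  qform (spin_mx x a b) x x = a%:C /\
  qform (spin_mx x a b) (perp x) (perp x) = b%:C.
Proof.
move=> /unitvP h.
rewrite !qformE !sum_ord2 !mxE !big_ord1 !mxE /= !(rmorphM, rmorphN) /= !conjCK.
by split; ring: h.
Qed.

(* For a unit vector [x] this is e_1 (x) e_1^* + e_2 (x) e_2^*, whatever [x] is; see [omegaE]. *)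
Definition omega x : 'rV[C]_4 :=
  tens x (conjv x) + tens (perp x) (conjv (perp x)).

Lemma omegaE x i j : unitv x -> omega x 0 (tidx i j) = (i == j)%:R.
Proof.
move=> /unitvP h.
rewrite mxE !tensE !conjvE.
case: (ord2P i) => ->; case: (ord2P j) => ->;
  rewrite ?perp0 ?perp1 ?rmorphN /= ?conjCK.
- by ring: h.
- by ring.
- by ring.
- by ring: h.
Qed.

Lemma mxtrace_Csymm p Pi x : unitv x ->
  \tr (Pi *m Csymm p) =
  (2 `^ p)%:C * (2 * \tr Pi - qform Pi (omega x) (omega x)).
Proof.
move=> x1.
have p1 : (2 `^ (p + 1))%:C = 2 * (2 `^ p)%:C :> C.
  by rewrite powRD ?pnatr_eq0 ?implybT // powRr1 // rmorphM rmorph_nat mulrC.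
have om00 := omegaE 0 0 x1; have om01 := omegaE 0 1 x1.
have om10 := omegaE 1 0 x1; have om11 := omegaE 1 1 x1.
rewrite eqxx in om00; rewrite eqxx in om11.
rewrite (_ : (0 == 1 :> 'I_2) = false) // in om01.
rewrite (_ : (1 == 0 :> 'I_2) = false) // in om10.
rewrite /mxtrace qformE !sum_tidx !sum_ord2 !sum_tidx !sum_ord2.
rewrite om00 om01 om10 om11 !rmorph_nat !(mulr0, mul0r, addr0, add0r, mulr1, mul1r).
rewrite !mxE !sum_tidx !sum_ord2 !mxE !val_tidx.
rewrite !(muln0, muln1, add0n, addn0, addn1, add1n) p1.
rewrite /=.
ring.
Qed.

(** * Cauchy-Schwarz bound for a positive form *)

Lemma conjC_realC (a : R) : ((a%:C : C)^* = a%:C)%R.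
Proof. exact: conjc_real. Qed.

Lemma conjtrD n (v w : 'rV[C]_n) (a b : R) :
  (a%:C *: v + b%:C *: w) ^t* = a%:C *: v ^t* + b%:C *: w ^t*.
Proof. by apply/matrixP => i j; rewrite !mxE rmorphD !rmorphM /= !conjC_realC. Qed.

Lemma qform_lincomb n (A : 'M[C]_n) (v w : 'rV[C]_n) (a b : R) :
  qform A (a%:C *: v + b%:C *: w) (a%:C *: v + b%:C *: w) =
  (a ^+ 2)%:C * qform A v v + (b ^+ 2)%:C * qform A w w +
  (a * b)%:C * (qform A v w + qform A w v).
Proof.
rewrite /qform conjtrD !mulmxDr !mulmxDl -!scalemxAl -!scalemxAr.
move: (v *m A *m v ^t*) (w *m A *m w ^t*) (v *m A *m w ^t*) (w *m A *m v ^t*).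
move=> vv ww vw wv; rewrite !mxE rmorphXn rmorphXn rmorphM /=.
ring.
Qed.

(** A nonnegative binary quadratic form has discriminant at most 0, so [c] is at most twice the root
    of [t * u], hence of [T * U]. *)
Lemma quad_le_sqr_sqrtD (t u c T U : R) :
  (forall a b : R, 0 <= a ^+ 2 * t + b ^+ 2 * u + a * b * c) ->
  t <= T -> u <= U -> t + u + c <= (Num.sqrt T + Num.sqrt U) ^+ 2.
Proof.
move=> pos tT uU.
have t0 : 0 <= t by have := pos 1 0; lra.
have u0 : 0 <= u by have := pos 0 1; lra.
have ctu : c ^+ 2 <= 4 * (t * u).
  (* At [(c, - 2t)] the form equals [t * (4tu - c^2)], and at [(- 2u, c)] it equals
     [u * (4tu - c^2)]; a positive [t] or [u] can be cancelled. If both vanish, the points [(1, 1)]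
     and [(1, -1)] force [c = 0]. *)
  have post := pos c (- (2 * t)); have posu := pos (- (2 * u)) c.
  have := t0; rewrite le_eqVlt => /predU1P[t00|tgt0]; last first.
    rewrite -subr_ge0 -(pmulr_rge0 _ tgt0); apply: le_trans post _.
    by rewrite le_eqVlt; apply/orP; left; apply/eqP; ring.
  have := u0; rewrite le_eqVlt => /predU1P[u00|ugt0]; last first.
    rewrite -subr_ge0 -(pmulr_rge0 _ ugt0); apply: le_trans posu _.
    by rewrite le_eqVlt; apply/orP; left; apply/eqP; ring.
  have := pos 1 1; have := pos 1 (-1); rewrite -t00 -u00 => cle0 cge0.
  have -> : c = 0 by lra.
  by rewrite expr0n !mulr0.
have T0 := le_trans t0 tT; have U0 := le_trans u0 uU.
rewrite sqrrD !sqr_sqrtr // -mulr_natr.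
have : c <= Num.sqrt T * Num.sqrt U * 2.
  apply: le_trans (ler_norm c) _.
  rewrite -ler_sqr ?nnegrE ?mulr_ge0 ?sqrtr_ge0 //.
  rewrite real_normK ?num_real // !exprMn !sqr_sqrtr //.
  apply: le_trans ctu _; have := ler_pM t0 u0 tT uU; lra.
lra.
Qed.

Lemma ge0_complexE (z : C) : 0 <= z -> z = (complex.Re z)%:C.
Proof. by case: z => a b; rewrite lecE /= => /andP[/eqP ->]. Qed.

Lemma qform_le_sqr_sqrtD n (A : 'M[C]_n) (v w : 'rV[C]_n) (T U : R) :
  psd A -> qform A v v <= T%:C -> qform A w w <= U%:C ->
  qform A (v + w) (v + w) <= ((Num.sqrt T + Num.sqrt U) ^+ 2)%:C.
Proof.
move=> [_ psdA]; have pos a b := psdA (a%:C *: v + b%:C *: w).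
move: (ge0_complexE (psdA v)) (ge0_complexE (psdA w)).
rewrite -!/(qform A _ _); set t := complex.Re _; set u := complex.Re _ => tE uE.
have vw : qform A (v + w) (v + w) = t%:C + u%:C + (qform A v w + qform A w v).
  by have := qform_lincomb A v w 1 1; rewrite !scale1r !expr1n mulr1 !mul1r tE uE.
(* The cross terms have a real sum, because the form is real at [v + w], [v] and [w]. *)
have cE : qform A v w + qform A w v = (complex.Re (qform A v w + qform A w v))%:C.
  have /ge0_complexE := psdA (v + w); rewrite -/(qform A _ _) vw.
  move/(congr1 (fun z => z - (t%:C + u%:C))); rewrite addrC addKr => ->.
  by rewrite -!rmorphD -rmorphB.
rewrite vw cE tE uE; set c := complex.Re _; rewrite -!rmorphD !lecR.
apply: quad_le_sqr_sqrtD => a b; have := pos a b.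
by rewrite -/(qform A _ _) qform_lincomb tE uE cE -!rmorphM -!rmorphD /= lecR.
Qed.

(** * Positivity, marginals and overlap of the optimal coupling *)

Lemma psd_gram n (v : 'rV[C]_n) : psd (v ^t* *m v).
Proof.
split; first by rewrite trmx_mul map_mxM trmxCK.
move=> w; rewrite mulmxA -mulmxA.
rewrite (_ : v *m w ^t* = (w *m v ^t*) ^t*); last by rewrite trmx_mul map_mxM trmxCK.
by rewrite mxE big_ord1 [X in _ * X]mxE [X in _ * Num.conj X]mxE mul_conjC_ge0.
Qed.

Lemma psdD n (A B : 'M[C]_n) : psd A -> psd B -> psd (A + B).
Proof.
move=> [hA pA] [hB pB]; split; first by rewrite linearD map_mxD hA hB.
by move=> v; rewrite mulmxDr mulmxDl mxE addr_ge0.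
Qed.

Lemma psdZ n (a : R) (A : 'M[C]_n) : 0 <= a -> psd A -> psd (a%:C *: A).
Proof.
move=> a0 [hA pA]; split.
  by rewrite linearZ /= map_mxZ /= conjC_realC hA.
by move=> v; rewrite -scalemxAr -scalemxAl mxE mulr_ge0 // lecR.
Qed.

(* In the basis u (x) conj v, with u, v among [x] and [perp x]: a pure part on the
   two diagonal vectors, and weights [c], [d] on the two off-diagonal ones. *)
Definition opt_coupling x (s t c d : R) : 'M[C]_4 :=
  let w := s%:C *: tens x (conjv x) + t%:C *: tens (perp x) (conjv (perp x)) in
  let g := tens x (conjv (perp x)) in let h := tens (perp x) (conjv x) in
  w ^t* *m w + c%:C *: (g ^t* *m g) + d%:C *: (h ^t* *m h).

Lemma psd_opt_coupling x s t c d : 0 <= c -> 0 <= d -> psd (opt_coupling x s t c d).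
Proof.
move=> c0 d0; apply: psdD; first apply: psdD; first exact: psd_gram.
- exact/psdZ/psd_gram.
- exact/psdZ/psd_gram.
Qed.

Lemma opt_couplingE x s t c d i j k l :
  opt_coupling x s t c d (tidx i j) (tidx k l) =
  ((s%:C * (x 0 i)^* * x 0 j + t%:C * (perp x 0 i)^* * perp x 0 j) *
   (s%:C * x 0 k * (x 0 l)^* + t%:C * perp x 0 k * (perp x 0 l)^* ) +
  c%:C * ((x 0 i)^* * perp x 0 j * (x 0 k * (perp x 0 l)^* )) +
  d%:C * ((perp x 0 i)^* * x 0 j * (perp x 0 k * (x 0 l)^* )))%R.
Proof.
have gramE (v : 'rV[C]_4) a b : ((v ^t* *m v) a b = (v 0 a)^* * v 0 b)%R.
  by rewrite mxE big_ord1 !mxE.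
have sumE a b (v w : 'rV[C]_4) e : (a *: v + b *: w) 0 e = a * v 0 e + b * w 0 e.
  by rewrite !mxE.
have sum3E (M N P : 'M[C]_4) a b e f :
    (M + a *: N + b *: P) e f = M e f + a * N e f + b * P e f.
  by rewrite !mxE.
rewrite /opt_coupling sum3E !gramE !sumE !tensE !conjvE.
rewrite !(rmorphD, rmorphM) /= !conjC_realC !conjCK.
ring.
Qed.

Lemma spin_mxE x a b i j : (spin_mx x a b i j =
  a%:C * ((x 0 i)^* * x 0 j) + b%:C * ((perp x 0 i)^* * perp x 0 j))%R.
Proof.
have E (e : C) y : ((e *: (y ^t* *m y)) i j = e * ((y 0 i)^* * y 0 j))%R.
  by rewrite !mxE big_ord1 !mxE.
by rewrite mxE !E.
Qed.

(** Orthogonality of [x] and [perp x] removes the interference terms of the pure part. *)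
Lemma ptr_dual_opt_coupling x s t c d : unitv x ->
  ptr_dual (opt_coupling x s t c d) = spin_mx x (s ^+ 2 + c) (t ^+ 2 + d).
Proof.
move=> /unitvP h; apply/matrixP => i j; rewrite spin_mxE mxE sum_ord2 !opt_couplingE.
rewrite ![perp x 0 0]perp0 ![perp x 0 1]perp1 !rmorphN /= !conjCK.
rewrite !rmorphD !rmorphXn /=.
ring: h.
Qed.

Lemma ptr_H_opt_coupling x s t c d : unitv x ->
  ptr_H (opt_coupling x s t c d) = (spin_mx x (s ^+ 2 + d) (t ^+ 2 + c))^T.
Proof.
move=> /unitvP h; apply/matrixP => i j; rewrite [RHS]mxE spin_mxE mxE sum_ord2.
rewrite !opt_couplingE.
rewrite ![perp x 0 0]perp0 ![perp x 0 1]perp1 !rmorphN /= !conjCK.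
rewrite !rmorphD !rmorphXn /=.
ring: h.
Qed.

Lemma mxtrace_ptr_dual Pi : \tr (ptr_dual Pi) = \tr Pi.
Proof. by rewrite /mxtrace sum_tidx; apply: eq_bigr => i _; rewrite mxE. Qed.

Lemma mxtrace_spin_mx x a b : unitv x -> \tr (spin_mx x a b) = (a + b)%:C.
Proof.
move=> /unitvP h; rewrite /mxtrace sum_ord2 !spin_mxE perp0 perp1 !rmorphN /= !conjCK.
rewrite rmorphD /=; ring: h.
Qed.

(** The off-diagonal vectors are orthogonal to [omega x], so only the pure part contributes. *)
Lemma qform_opt_coupling x s t c d : unitv x ->
  qform (opt_coupling x s t c d) (omega x) (omega x) = ((s + t) ^+ 2)%:C.
Proof.
move=> x1; have h := unitvP x1.
rewrite qformE !sum_tidx !sum_ord2 !sum_tidx !sum_ord2.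
rewrite ![omega x 0 _]omegaE // eqxx (_ : (0 == 1 :> 'I_2) = false) // (_ : (1 == 0 :> 'I_2) = false) //.
rewrite !rmorph_nat !(mulr0, mul0r, addr0, add0r, mulr1, mul1r) !opt_couplingE.
rewrite !perp0 !perp1 !rmorphN /= !conjCK rmorphXn rmorphD /=.
ring: h.
Qed.

(** * Minimal cost between two states diagonal in the same basis *)

Lemma min_cost_spin_mx x (p a b : R) : unitv x ->
  0 <= a <= 1 -> 0 <= b <= 1 ->
  min_cost p (spin_mx x b (1 - b)) (spin_mx x a (1 - a))
    (2 `^ p * (2 - (Num.sqrt (Num.min a b) + Num.sqrt (1 - Num.max a b)) ^+ 2)).
Proof.
move=> x1 /andP[a0 a1] /andP[b0 b1].
set T := Num.min a b; set U := 1 - Num.max a b.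
have T0 : 0 <= T by rewrite le_min a0.
have U0 : 0 <= U by rewrite subr_ge0 ge_max a1.
have TU : T = a + b - Num.max a b by rewrite -(addr_min_max a b) addrK.
have TaT : T + (a - T) = a by rewrite subrKC.
have TbT : T + (b - T) = b by rewrite subrKC.
have UbT : U + (b - T) = 1 - a by rewrite /U TU; ring.
have UaT : U + (a - T) = 1 - b by rewrite /U TU; ring.
have sT : Num.sqrt T ^+ 2 = T by rewrite sqr_sqrtr.
have sU : Num.sqrt U ^+ 2 = U by rewrite sqr_sqrtr.
have costE : (2 `^ p * (2 - (Num.sqrt T + Num.sqrt U) ^+ 2))%:C =
    (2 `^ p)%:C * (2 * 1 - ((Num.sqrt T + Num.sqrt U) ^+ 2)%:C) :> C.
  by rewrite rmorphM rmorphB rmorph_nat mulr1.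
split.
  (* The weights [a - T] and [b - T] are the mass missing from the marginals; one of them is
     zero. *)
  pose Pi := opt_coupling x (Num.sqrt T) (Num.sqrt U) (a - T) (b - T).
  have dualE : ptr_dual Pi = spin_mx x a (1 - a).
    by rewrite /Pi (ptr_dual_opt_coupling _ _ _ _ x1) sT sU TaT UbT.
  have HE : ptr_H Pi = (spin_mx x b (1 - b))^T.
    by rewrite /Pi (ptr_H_opt_coupling _ _ _ _ x1) sT sU TbT UaT.
  have trPi : \tr Pi = 1 by rewrite -mxtrace_ptr_dual dualE mxtrace_spin_mx // subrKC.
  exists Pi; split.
    split; last by [].
    by split => //; apply: psd_opt_coupling; rewrite subr_ge0 ge_min lexx ?orbT.
  by rewrite (mxtrace_Csymm _ _ x1) trPi qform_opt_coupling // costE.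
move=> Pi [[psdPi trPi] [dualE HE]].
have pos (v : 'rV[C]_4) : 0 <= qform Pi v v by case: psdPi => _; apply.
rewrite (mxtrace_Csymm _ _ x1) trPi costE ler_wpM2l ?lecR ?powR_ge0 // lerB //.
apply: qform_le_sqr_sqrtD => //.
  (* The two marginals bound the entry at [x (x) conj x] by [a] and by [b]. *)
  have da := qform_ptr_dual Pi x x1; have db := qform_ptr_H Pi (conjv x) x1.
  rewrite dualE (qform_spin_mx a (1 - a) x1).1 in da.
  rewrite HE qform_tr_conjv (qform_spin_mx b (1 - b) x1).1 in db.
  by rewrite /T /Num.min; case: ifP => _; rewrite -?da -?db lerDl pos.
(* Likewise the entry at the other diagonal vector is at most [1 - a] and [1 - b]. *)
have da := qform_ptr_dual Pi (perp x) x1.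
have db := qform_ptr_H Pi (conjv (perp x)) x1.
rewrite dualE (qform_spin_mx a (1 - a) x1).2 in da.
rewrite HE qform_tr_conjv (qform_spin_mx b (1 - b) x1).2 in db.
by rewrite /U /Num.max; case: ifP => _; rewrite -?da -?db lerDr pos.
Qed.

(** * Bloch vectors on a common axis *)

Lemma bloch_spin_mx (n : 'rV[R]_3) : dot3 n n = 1 -> exists2 x, unitv x &
  forall s, bloch (s *: n) = spin_mx x ((1 + s) / 2) (1 - (1 + s) / 2).
Proof.
rewrite /dot3 !big_ord_recl big_ord0 addr0.
set n1 := n 0 ord0; set n2 := n 0 _; set n3 := n 0 _ => n1E.
have [X [z [w [e0 e1 e2 e3]]]] : exists X z w : R, [/\ X ^+ 2 + z ^+ 2 + w ^+ 2 = 1,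
    n1 = 2 * X * z, n2 = 2 * X * w & n3 = X ^+ 2 - z ^+ 2 - w ^+ 2].
  (* (X, z + i w) is the spin-up eigenvector along n; at the south pole X = 0. *)
  have [n31|n31] := eqVneq n3 (-1).
    have : n1 ^+ 2 + n2 ^+ 2 = 0 by rewrite n31 in n1E; lra.
    move/eqP; rewrite paddr_eq0 ?sqr_ge0 // !sqrf_eq0 => /andP[/eqP n10 /eqP n20].
    by exists 0, 1, 0; rewrite n10 n20 n31; split; ring.
  have n3gt : 0 < (1 + n3) / 2.
    have : 0 <= (1 - n3) * (1 + n3).
      have := sqr_ge0 n1; have := sqr_ge0 n2; move: n1E; rewrite !expr2; lra.
    have [n3lt|n3gt _|n3E] := ltrgtP n3 (-1); last by rewrite n3E eqxx in n31.
      by rewrite nmulr_lge0; lra.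
    by lra.
  pose X := Num.sqrt ((1 + n3) / 2).
  have X2 : X ^+ 2 = (1 + n3) / 2 by rewrite sqr_sqrtr // ltW.
  have X0 : X != 0 by rewrite gt_eqF // sqrtr_gt0.
  exists X, (n1 / (2 * X)), (n2 / (2 * X)).
  have zw : (n1 / (2 * X)) ^+ 2 + (n2 / (2 * X)) ^+ 2 = (1 - n3) / 2.
    rewrite !expr_div_n !exprMn X2 -mulrDl.
    have -> : n1 ^+ 2 + n2 ^+ 2 = (1 - n3) * (1 + n3) by move: n1E; lra.
    by field; rewrite gt_eqF //; lra.
  split; try by field.
  - by rewrite -addrA zw X2; field.
  - by rewrite -addrA -opprD zw X2; field.
(* The second entry is conjugated because [spin_mx] projects onto the column [x ^t*]. *)
exists (\row_j (if j == 0 then X%:C else (z -i* w))).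
  rewrite /unitv !mxE /=; apply/eqP; rewrite eq_complex /=.
  by apply/andP; split; apply/eqP; lra.
move=> s; apply/matrixP => i j; rewrite spin_mxE.
have halfE : (2%:R^-1 : C) = (2^-1)%:C by rewrite fmorphV rmorph_nat.
rewrite !mxE halfE !big_ord_recl big_ord0 addr0.
case: (ord2P i) => ->; case: (ord2P j) => ->; rewrite ?perp0 ?perp1 !mxE /=;
  rewrite -/n1 -/n2 -/n3 e1 e2 e3;
  apply/eqP; rewrite eq_complex /=; apply/andP; split; apply/eqP.
all: lra.
Qed.

End Couplings.

Lemma dot3Z (R : realType) (n : 'rV[R]_3) s t :
  dot3 n n = 1 -> dot3 (s *: n) (t *: n) = s * t.
Proof.
move=> n1; rewrite -[RHS]mulr1 -n1 /dot3 mulr_sumr.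
by apply: eq_bigr => k _; rewrite !mxE; ring.
Qed.

Lemma norm3Z (R : realType) (n : 'rV[R]_3) s :
  dot3 n n = 1 -> norm3 (s *: n) = `|s|.
Proof. by move=> n1; rewrite /norm3 dot3Z // -expr2 sqrtr_sqr. Qed.

Lemma unit_direction (R : realType) (r : 'rV[R]_3) :
  exists2 n : 'rV[R]_3, dot3 n n = 1 & exists s, r = s *: n.
Proof.
have [->|r0] := eqVneq r 0.
  exists (delta_mx 0 0); last by exists 0; rewrite scale0r.
  rewrite /dot3 (bigD1 0) //= big1 ?mxE ?mulr1 ?addr0 // => k k0.
  by rewrite mxE (negbTE k0) andbF mulr0.
have rr_gt0 : 0 < dot3 r r.
  rewrite lt_def sumr_ge0 ?andbT => [|k _]; last by rewrite -expr2 sqr_ge0.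
  apply: contraNneq r0 => rr0; apply/eqP/rowP => k; rewrite mxE.
  apply/eqP; rewrite -sqrf_eq0 expr2; apply/eqP.
  by apply: (psumr_eq0P _ rr0) => // j _; rewrite -expr2 sqr_ge0.
have nr0 : norm3 r != 0 by rewrite gt_eqF // sqrtr_gt0.
exists ((norm3 r)^-1 *: r); last by exists (norm3 r); rewrite scalerA divff ?scale1r.
have -> : dot3 ((norm3 r)^-1 *: r) ((norm3 r)^-1 *: r) = (norm3 r) ^- 2 * dot3 r r.
  by rewrite /dot3 mulr_sumr; apply: eq_bigr => k _; rewrite !mxE -exprVn; ring.
by rewrite sqr_sqrtr ?ltW // mulVf // gt_eqF.
Qed.

(** Dependence gives [a r1 + b r2 = 0] with [(a, b)] nonzero. Either [r1] is a multiple of [r2], or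
    [a = 0] and then [r2 = 0]. *)
Lemma common_direction (R : realType) (r1 r2 : 'rV[R]_3) :
  ~~ row_free (col_mx r1 r2) ->
  exists2 n : 'rV[R]_3, dot3 n n = 1 &
  exists s1 s2, r1 = s1 *: n /\ r2 = s2 *: n.
Proof.
rewrite -kermx_eq0 => /rowV0Pn[w /sub_kermxP]; rewrite -[w]hsubmxK mul_row_col.
set a := lsubmx w; set b := rsubmx w.
rewrite [a]mx11_scalar [b]mx11_scalar !mul_scalar_mx.
move: (a 0 0) (b 0 0) => {a b}a b ab0 w0.
have [a0|a0] := eqVneq a 0.
  have b0 : b != 0.
    apply: contraNneq w0 => b0; rewrite a0 b0 !raddf0.
    by rewrite row_mx0.
  have [n n1 [s r1E]] := unit_direction r1; exists n => //; exists s, 0; split=> //.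
  by move/eqP: ab0; rewrite a0 !scale0r add0r scaler_eq0 (negbTE b0) => /eqP.
have [n n1 [s r2E]] := unit_direction r2; exists n => //.
exists (- (a^-1 * b * s)), s; split=> //.
move/eqP: ab0; rewrite addr_eq0 => /eqP /(congr1 ( *:%R a^-1)).
by rewrite scalerA mulVf // scale1r r2E => ->; rewrite scalerN !scalerA scaleNr.
Qed.

(** The number of larger absolute value is the maximum if nonnegative and the minimum if negative,
    and [q] is the other number times its sign. *)
Lemma collinear_sqrtE (R : realType) (s1 s2 : R) :
  let m := Num.max `|s1| `|s2| in
  let q := if m == 0 then 0 else s1 * s2 / m in
  (1 + q) * (1 - m) = (1 + Num.min s1 s2) * (1 - Num.max s1 s2).
Proof.
move=> m q.
(* The convention for [m = 0] is harmless here, since then [s1 = 0]. *)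
have mqE : q * m = s1 * s2.
  rewrite /q; case: eqP => [m0|/eqP m0]; last by rewrite mulfVK.
  have : `|s1| <= m by rewrite /m le_max lexx.
  by rewrite m0 normr_le0 => /eqP ->; rewrite !mul0r.
have qE t : m != 0 -> s1 * s2 = t * m -> q = t.
  by move=> m0 tE; apply: (mulIf m0); rewrite mqE.
have [m0|m0] := eqVneq m 0.
  have : `|s1| <= m by rewrite /m le_max lexx.
  have : `|s2| <= m by rewrite /m le_max lexx orbT.
  rewrite /q m0 eqxx !normr_le0 => /eqP -> /eqP ->.
  by rewrite minxx maxxx.
have [s12|s21] := lerP `|s1| `|s2|.
  have mE : m = `|s2| by rewrite /m max_r.
  have [s20|s20] := lerP 0 s2.
    rewrite ger0_norm // in mE; rewrite mE in qE m0 s12 *.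
    have s1s2 : s1 <= s2 by rewrite (le_trans (ler_norm _)) // (le_trans s12) // ger0_norm.
    by rewrite min_l // max_r // (qE s1).
  rewrite ltr0_norm // in mE s12; rewrite mE in qE m0 *.
  have s2s1 : s2 <= s1 by have := ler_norm (- s1); rewrite normrN; lra.
  have -> : q = - s1 by apply: qE => //; ring.
  by rewrite min_r // max_l //; ring.
have mE : m = `|s1| by rewrite /m max_l // ltW.
have [s10|s10] := lerP 0 s1.
  rewrite ger0_norm // in mE s21; rewrite mE in qE m0 *.
  have s2s1 : s2 <= s1 by rewrite (le_trans (ler_norm _)) // ltW.
  have -> : q = s2 by apply: qE => //; ring.
  by rewrite min_r // max_l.
rewrite (ltr0_norm s10) in mE s21; rewrite mE in qE m0 *.
have s1s2 : s1 <= s2 by have := ler_norm (- s2); rewrite normrN; lra.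
have -> : q = - s2 by apply: qE => //; ring.
by rewrite min_l // max_r //; ring.
Qed.

Theorem theorem3p2 (R : realType) (r1 r2 : 'rV[R]_3) (p : R) :
  norm3 r1 <= 1 -> norm3 r2 <= 1 ->
  ~~ row_free (col_mx r1 r2) ->
  1 <= p ->
  let m := Num.max (norm3 r1) (norm3 r2) in
  let q := if m == 0 then 0 else dot3 r1 r2 / m in
  min_cost p (bloch r1) (bloch r2)
    ((2 : R) `^ p * (1 + 2^-1 * norm3 (r1 - r2) - Num.sqrt ((1 + q) * (1 - m)))).
Proof.
move=> n1 n2 /common_direction[n nn [s1 [s2 [r1E r2E]]]] _; move: n1 n2.
rewrite {r1}r1E {r2}r2E -scalerBl !norm3Z // dot3Z // => s1le s2le m q.
rewrite collinear_sqrtE.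
have [x x1 blochE] := bloch_spin_mx nn; rewrite !blochE.
have half (s : R) : `|s| <= 1 -> 0 <= (1 + s) / 2 <= 1.
  by rewrite ler_norml => /andP[? ?]; apply/andP; split; lra.
(* In the expanded square the two squared roots add up to [1 - |s1 - s2| / 2]; the cross term
   supplies the remaining root. *)
suff -> : 1 + 2^-1 * `|s1 - s2| - Num.sqrt ((1 + Num.min s1 s2) * (1 - Num.max s1 s2))
    = 2 - (Num.sqrt (Num.min ((1 + s2) / 2) ((1 + s1) / 2)) +
           Num.sqrt (1 - Num.max ((1 + s2) / 2) ((1 + s1) / 2))) ^+ 2.
  exact: min_cost_spin_mx x1 (half _ s2le) (half _ s1le).
wlog s12 : s1 s2 s1le s2le {m q} / s1 <= s2.
  move=> H; have [s12|s21] := orP (le_total s1 s2); first exact: H.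
  by rewrite distrC minC maxC (minC (_ / _)) (maxC (_ / _)); apply: H.
have h12 : (1 + s1) / 2 <= (1 + s2) / 2 by lra.
have {half} [/andP[a0 _] /andP[_ b1]] := (half _ s1le, half _ s2le).
rewrite (min_l s12) (max_r s12) (min_r h12) (max_l h12).
rewrite ler0_norm ?subr_le0 // sqrrD !sqr_sqrtr ?subr_ge0 // -sqrtrM //.
(* The factor 4 leaves the root as the 2 of the cross term. *)
have -> : (1 + s1) * (1 - s2) = 2 ^+ 2 * ((1 + s1) / 2 * (1 - (1 + s2) / 2)) by field.
rewrite [Num.sqrt (2 ^+ 2 * _)]sqrtrM ?sqr_ge0 // sqrtr_sqr ger0_norm // -mulr_natl.
by field.
Qed.
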